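(* Let $e_1,\dots,e_m$ be any multigraph edge stream, $\alpha,\beta\in(0,1)$, $\Delta t\ge0$, run MG-Triangle$(\alpha,\beta,\Delta t)$ as described in the context, and fix a time $t$. Let $\gamma>0$ be sufficiently small. Suppose that $\alpha^2\beta\,|W_t|\ge 1/\gamma^6$ and $|W_t|\ge|E_t|$. Then $\Pr\big[|\widehat W_t-|W_t||>\gamma|W_t|\big]<\gamma$, $\Pr\big[|\widehat T_t-|T_t||>\gamma|W_t|\big]<\gamma$, and $\Pr\big[|\widehat\tau_t-\tau_t|>8\gamma\big]<4\gamma$.
   Context: A multigraph edge stream is a sequence $e_1,\dots,e_m$ of unordered pairs of distinct vertex ids; the same pair may occur several times. For $t'\le t$, $G[t',t]$ denotes the simple undirected graph whose edge set is the set of distinct pairs among $e_{t'},\dots,e_t$; $G_t=G[\max(1,t-\Delta t),t]$. A wedge is a path of length $2$, i.e. an unordered pair of distinct edges $\{(u,v),(u,w)\}$ sharing exactly one vertex $u$; its closing edge is $(v,w)$; a wedge is closed if it lies in a triangle. $E_t$, $W_t$, $T_t$ denote the sets of edges, wedges and triangles of $G_t$, and $\tau_t=3|T_t|/|W_t|$ is its transitivity. $hash$ is a uniformly random function assigning to every edge and every wedge an independent uniform value in $(0,1)$; probabilities are over $hash$ only. Algorithm MG-Triangle$(\alpha,\beta,\Delta t)$ keeps a set \textit{e-list} of edges, a set \textit{w-list} of wedges, and for each $w\in$ \textit{w-list} a bit $X_w$; all start empty. For each $t=1,\dots,m$, on seeing $e_t$: (1) Update: if $hash(e_t)\le\alpha$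 and $e_t\notin$ \textit{e-list}, insert $e_t$ into \textit{e-list}, and for each wedge $w=\{e,e_t\}$ with $e\in$ \textit{e-list}, if $hash(w)\le\beta$ and $w\notin$ \textit{w-list}, insert $w$ into \textit{w-list} (with $X_w=0$). (2) For each $w=\{(u,v),(u,w')\}\in$ \textit{w-list}: if $e_t$ is the closing edge $(v,w')$ set $X_w=1$; else if $e_t\in\{(u,v),(u,w')\}$ reset $X_w=0$. (3) Let $\mathcal W$ be the set of wedges in \textit{w-list} that belong to $W_t$; output $\widehat T_t=(\alpha^2\beta)^{-1}\sum_{w\in\mathcal W}X_w$, $\widehat W_t=(\alpha^2\beta)^{-1}|\mathcal W|$, and $\widehat\tau_t=3\widehat T_t/\widehat W_t$ (with $\widehat\tau_t=0$ if $\widehat W_t=0$). *)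

(* Defs.v *)
From HB Require Import structures.
From mathcomp Require Import all_boot all_order all_algebra.
From mathcomp Require Import all_classical all_reals all_analysis.

Set Implicit Arguments.
Unset Strict Implicit.
Unset Printing Implicit Defensive.

Import Order.TTheory GRing.Theory Num.Theory.
Import numFieldNormedType.Exports.

Local Open Scope ring_scope.

(* {set T}, [set x | b], [set a; b] below are finite sets (finset.v); the set
   notations of classical_sets.v are marked %classic. *)
Local Open Scope set_scope.

Definition edge (V : finType) := {e : {set V} | #|e| == 2%N}.

Definition wedge_center (V : finType) (w : {set edge V}) : {set V} :=
  \bigcap_(e in w) val e.

Definition is_wedge (V : finType) (w : {set edge V}) : bool :=
  (#|w| == 2%N) && (#|wedge_center w| == 1%N).

Definition wedge (V : finType) := {w : {set edge V} | is_wedge w}.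

Definition closing_edge (V : finType) (w : wedge V) (e : edge V) : bool :=
  val e == (\bigcup_(f in val w) val f) :\: wedge_center (val w).

Section Graph.
Variables (V : finType) (es : seq (edge V)).

(* Stream positions are numbered from 1, so e_i is the entry of es at i.-1. *)
Definition stream_edges (t' t : nat) : {set edge V} :=
  [set e in drop t'.-1 (take t es)].

Definition E_ (Dt t : nat) : {set edge V} := stream_edges (maxn 1 (t - Dt)) t.

Definition W_ (Dt t : nat) : {set wedge V} :=
  [set w : wedge V | val w \subset E_ Dt t].

(* A triangle is given by its three vertices. *)
Definition T_ (Dt t : nat) : {set {set V}} :=
  [set s : {set V} | (#|s| == 3%N) &&
     [forall e : edge V, (val e \subset s) ==> (e \in E_ Dt t)]].

Definition tau_ (R : realType) (Dt t : nat) : R :=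
  3 * #|T_ Dt t|%:R / #|W_ Dt t|%:R.

End Graph.

(* One hash function serves both edges and wedges. *)
Definition hash_key (V : finType) := (edge V + wedge V)%type.

(* x_bit is meaningful only on w_list. *)
Record mg_state (V : finType) := MGState {
  e_list : {set edge V};
  w_list : {set wedge V};
  x_bit : wedge V -> bool
}.

Section Algorithm.
Variables (R : realType) (V : finType) (alpha beta : R) (h : hash_key V -> R).

Definition mg_init : mg_state V := MGState finset.set0 finset.set0 (fun _ => false).

Definition mg_update (s : mg_state V) (et : edge V) : mg_state V :=
  if (h (inl et) <= alpha) && (et \notin e_list s) then
    let el := et |: e_list s in
    let new := [set w : wedge V |
      [&& [exists e in el, val w == [set e; et]],
          h (inr w) <= beta & w \notin w_list s]] in
    MGState el (w_list s :|: new)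
            (fun w => if w \in new then false else x_bit s w)
  else s.

Definition mg_refresh (s : mg_state V) (et : edge V) : mg_state V :=
  MGState (e_list s) (w_list s)
    (fun w => if w \in w_list s then
                if closing_edge w et then true
                else if et \in val w then false
                else x_bit s w
              else x_bit s w).

Definition mg_step (s : mg_state V) (et : edge V) : mg_state V :=
  mg_refresh (mg_update s et) et.

Definition mg_run (es : seq (edge V)) (t : nat) : mg_state V :=
  foldl mg_step mg_init (take t es).

Variables (es : seq (edge V)) (Dt t : nat).

Definition live_wedges : {set wedge V} := w_list (mg_run es t) :&: W_ es Dt t.

Definition T_hat : R :=
  (alpha ^+ 2 * beta)^-1 *
  \sum_(w in live_wedges) (x_bit (mg_run es t) w)%:R.

Definition W_hat : R := (alpha ^+ 2 * beta)^-1 * #|live_wedges|%:R.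

Definition tau_hat : R := if W_hat == 0 then 0 else 3 * T_hat / W_hat.

End Algorithm.

Section RandomHash.
Context (R : realType) (d : measure_display) (Omega : measurableType d).
Variable P : probability Omega R.

Definition mutually_independent (I : finType) (X : I -> {RV P >-> R}) : Prop :=
  forall (J : {set I}) (B : I -> set R),
    (forall i, i \in J -> measurable (B i)) ->
    (P (\bigcap_(i in [set` J]) (X i @^-1` B i))%classic =
     \prod_(i in J) P (X i @^-1` B i)%classic)%E.

Definition uniform01 (X : {RV P >-> R}) : Prop :=
  forall A : set R, measurable A ->
    distribution P X A = uniform_prob (@ltr01 R) A.

Definition random_hash (V : finType) (hash : hash_key V -> {RV P >-> R}) : Prop :=
  mutually_independent hash /\ forall k, uniform01 (hash k).

End RandomHash.

(* Main.v *)
(** The output depends on the hash only through the independent bits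
    [hash e <= alpha] and [hash w <= beta].  At time [t] the list of wedges
    consists of the wedges [w = {e1, e2}] seen so far with [a1 a2 b = 1], where
    [a1], [a2], [b] are the bits of [e1], [e2], [w]; and [X_w = 1] iff the last
    occurrence of the closing edge is later than those of [e1] and [e2].  Hence
    every triangle of [G_t] contains exactly one wedge with [X_w = 1], and both
    estimators are sums of [a1 a2 b] over a set [S] of wedges of [G_t].

    With [A = a - alpha] and [B = b - beta], the deviation
    [a1 a2 b - alpha^2 beta] equals
    [alpha beta (A1 + A2) + beta A1 A2 + a1 a2 B].  The last two families are
    orthogonal over distinct wedges, so Chebyshev's inequality applies with room
    to spare.  The first part sums to [alpha beta \sum_e c_e A_e], where [c_e] is
    the number of wedges of [S] through [e]; since the edges at a vertex form
    wedges pairwise, [c_e <= 3 sqrt |W_t|], and its fourth moment gives a tail of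
    order [gamma^2].  The bound on the transitivity is a deterministic
    consequence of the other two. *)

Require Import Defs.
From HB Require Import structures.
From mathcomp Require Import all_boot all_order all_algebra.
From mathcomp Require Import all_classical all_reals all_analysis.
From mathcomp Require Import ring lra.

Set Implicit Arguments.
Unset Strict Implicit.
Unset Printing Implicit Defensive.

Import Order.TTheory GRing.Theory Num.Theory.
Import numFieldNormedType.Exports.

Local Open Scope ring_scope.
Local Open Scope classical_set_scope.

(** * Expectations under a finite product of Bernoulli laws *)

Section BernoulliProduct.
Variables (R : realFieldType) (K : finType) (p : K -> R).
Implicit Types (f : {ffun K -> bool}) (F G : {ffun K -> bool} -> R) (k : K).

Definition bern_mass (f : {ffun K -> bool}) : R :=
  \prod_k (if f k then p k else 1 - p k).

Definition bern_exp (F : {ffun K -> bool} -> R) : R :=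
  \sum_f bern_mass f * F f.

Definition setbit (f : {ffun K -> bool}) (k : K) (b : bool) : {ffun K -> bool} :=
  [ffun j => if j == k then b else f j].

Lemma eq_bern_exp F G : F =1 G -> bern_exp F = bern_exp G.
Proof. by move=> FG; apply: eq_bigr => f _; rewrite FG. Qed.

Lemma bern_expD F G :
  bern_exp (fun f => F f + G f) = bern_exp F + bern_exp G.
Proof. by rewrite /bern_exp -big_split; apply: eq_bigr => f _; rewrite mulrDr. Qed.

Lemma bern_expZ a F : bern_exp (fun f => a * F f) = a * bern_exp F.
Proof. by rewrite /bern_exp mulr_sumr; apply: eq_bigr => f _; rewrite mulrCA. Qed.

Lemma bern_exp_sum (I : Type) (r : seq I) (Q : pred I)
    (Y : I -> {ffun K -> bool} -> R) :
  bern_exp (fun f => \sum_(i <- r | Q i) Y i f) =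
  \sum_(i <- r | Q i) bern_exp (Y i).
Proof.
rewrite /bern_exp exchange_big; apply: eq_bigr => f _.
by rewrite mulr_sumr.
Qed.

Lemma bern_exp_cst a : bern_exp (fun=> a) = a.
Proof.
rewrite /bern_exp -mulr_suml -[RHS]mul1r; congr (_ * _).
rewrite /bern_mass -(bigA_distr_bigA (fun k (b : bool) =>
  if b then p k else 1 - p k)) big1// => k _.
by rewrite big_bool/= addrC subrK.
Qed.

Lemma setbit_setbit f k b b' : setbit (setbit f k b) k b' = setbit f k b'.
Proof. by apply/ffunP => j; rewrite !ffunE; case: eqP. Qed.

Lemma setbit_id f k b : f k = b -> setbit f k b = f.
Proof. by move=> <-; apply/ffunP => j; rewrite ffunE; case: eqP => [->|]. Qed.

Lemma setbitE f k b : setbit f k b k = b.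
Proof. by rewrite ffunE eqxx. Qed.

Lemma setbit_neq f k b j : j != k -> setbit f k b j = f j.
Proof. by rewrite ffunE => /negbTE ->. Qed.

(** Configurations are paired when they differ only at [k], and each pair is indexed by its member
    with bit [true]. The product over [j != k] is the mass that the pair has in common. *)
Lemma bern_exp_split k F :
  bern_exp F = \sum_(f : {ffun K -> bool} | f k)
    (\prod_(j | j != k) (if f j then p j else 1 - p j)) *
    (p k * F (setbit f k true) + (1 - p k) * F (setbit f k false)).
Proof.
have part b : \sum_(f : {ffun K -> bool} | f k == b) bern_mass f * F f =
    \sum_(f : {ffun K -> bool} | f k)
      (\prod_(j | j != k) (if f j then p j else 1 - p j)) *
      ((if b then p k else 1 - p k) * F (setbit f k b)).
  rewrite (reindex_onto (fun f => setbit f k b) (fun f => setbit f k true))/=; last first.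
    by move=> f /eqP fk; rewrite setbit_setbit setbit_id.
  apply: eq_big => [f|f /andP[_ /eqP fk]].
    rewrite setbitE eqxx/= setbit_setbit; apply/eqP/idP => [<-|fk].
      by rewrite setbitE.
    exact: setbit_id.
  rewrite mulrA; congr (_ * _); rewrite /bern_mass (bigD1 k)//= setbitE mulrC.
  by congr (_ * _); apply: eq_bigr => j jk; rewrite setbit_neq.
rewrite /bern_exp (bigID (fun f => f k == true))/= (part true).
rewrite (eq_bigl (fun f => f k == false)) ?(part false); last by move=> f; case: (f k).
by rewrite -big_split/=; apply: eq_bigr => f _; rewrite -mulrDr.
Qed.

(** This is conditioning on all bits but [k]. The averaged integrand is still a function on the full
    space, so the step can be iterated; both sides have the same splitting because a second [setbit]
    at [k] overwrites the first. *)
Lemma bern_exp_cond k F :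
  bern_exp F = bern_exp (fun f =>
    p k * F (setbit f k true) + (1 - p k) * F (setbit f k false)).
Proof.
rewrite (bern_exp_split k F) (bern_exp_split k (fun f => _)).
apply: eq_bigr => f _; congr (_ * _); rewrite !setbit_setbit; ring.
Qed.

Lemma bern_exp_factor k (phi : bool -> R) G :
  (forall f b, G (setbit f k b) = G f) ->
  bern_exp (fun f => phi (f k) * G f) =
  (p k * phi true + (1 - p k) * phi false) * bern_exp G.
Proof.
move=> Gk; rewrite (bern_exp_cond k) -bern_expZ.
by apply: eq_bern_exp => f; rewrite !setbitE !Gk; ring.
Qed.

Lemma bern_exp_centered k G : (forall f b, G (setbit f k b) = G f) ->
  bern_exp (fun f => ((f k)%:R - p k) * G f) = 0.
Proof.
by move=> Gk; rewrite (bern_exp_factor (fun b => b%:R - p k))//=; ring.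
Qed.

Lemma bern_exp_sqr_sum (I : finType) (A : {set I})
    (Y : I -> {ffun K -> bool} -> R) :
  (forall i j, i \in A -> j \in A -> i != j ->
     bern_exp (fun f => Y i f * Y j f) = 0) ->
  bern_exp (fun f => (\sum_(i in A) Y i f) ^+ 2) =
  \sum_(i in A) bern_exp (fun f => Y i f ^+ 2).
Proof.
move=> Yij.
under eq_bern_exp do rewrite expr2 mulr_suml.
rewrite bern_exp_sum; apply: eq_bigr => i iA.
under eq_bern_exp do rewrite mulr_sumr.
rewrite bern_exp_sum (bigD1 i)//= [X in _ + X]big1 ?addr0// => j /andP[jA ji].
by apply: Yij => //; rewrite eq_sym.
Qed.

Hypothesis p01 : forall k, 0 <= p k <= 1.

Lemma bern_mass_ge0 f : 0 <= bern_mass f.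
Proof.
by apply: prodr_ge0 => k _; have /andP[? ?] := p01 k; case: ifP => // _; rewrite subr_ge0.
Qed.

Lemma le_bern_exp F G : (forall f, F f <= G f) -> bern_exp F <= bern_exp G.
Proof. by move=> FG; apply: ler_sum => f _; rewrite ler_wpM2l ?bern_mass_ge0. Qed.

Section LinearForm.
Variable c : K -> R.
Let L (s : seq K) f := \sum_(k <- s) c k * ((f k)%:R - p k).

Let L_setbit k s f b : k \notin s -> L s (setbit f k b) = L s f.
Proof.
move=> ks; apply: eq_big_seq => j js; rewrite setbit_neq//.
by apply: contraNneq ks => <-.
Qed.

Lemma bern_exp_linear s : bern_exp (L s) = 0.
Proof.
rewrite /L bern_exp_sum big1// => k _; rewrite bern_expZ.
rewrite (@eq_bern_exp _ (fun f => ((f k)%:R - p k) * 1)) ?bern_exp_centered ?mulr0//.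
by move=> f; rewrite mulr1.
Qed.

Lemma bern_exp_linear_sqr s : uniq s ->
  bern_exp (fun f => L s f ^+ 2) = \sum_(k <- s) c k ^+ 2 * (p k * (1 - p k)).
Proof.
elim: s => [_|k s IHs /andP[ks us]].
  rewrite big_nil -[RHS](bern_exp_cst 0); apply: eq_bern_exp => f.
  by rewrite /L big_nil expr0n.
rewrite big_cons -IHs// -[X in X + _]bern_exp_cst -bern_expD (bern_exp_cond k).
apply: eq_bern_exp => f; have := fun b => L_setbit f b ks.
by rewrite /L !big_cons => e; rewrite !e !setbitE/=; ring.
Qed.

(** Induction on [s]: adding a centred independent term [X] to [L] leaves only [L^4], [6 X^2 L^2]
    and [X^4] in expectation. The mixed term is absorbed by the cross term of the enlarged square,
    and [X^4] by the last sum. *)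
Lemma bern_exp_linear_pow4 s : uniq s ->
  bern_exp (fun f => L s f ^+ 4) <=
  3 * (\sum_(k <- s) c k ^+ 2 * p k) ^+ 2 + \sum_(k <- s) c k ^+ 4 * p k.
Proof.
elim: s => [_|k s IHs /andP[ks us]].
  rewrite !big_nil expr0n mulr0 addr0 -[leRHS](bern_exp_cst 0).
  by apply: le_bern_exp => f; rewrite /L big_nil expr0n.
have /andP[p0 p1] := p01 k; set q := p k in p0 p1 *.
have -> : bern_exp (fun f => L (k :: s) f ^+ 4) =
   bern_exp (fun f => L s f ^+ 4) + (6 * c k ^+ 2 * (q * (1 - q))) * bern_exp (fun f => L s f ^+ 2)
   + c k ^+ 4 * (q * (1 - q) * ((1 - q) ^+ 3 + q ^+ 3)).
  rewrite -[X in _ + X]bern_exp_cst -bern_expZ -!bern_expD (bern_exp_cond k).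
  (* The average over bit [k] also has a term in [L] times the third central moment. It is added
     here as a multiple of the mean of [L], which is zero, so that the identity becomes pointwise in
     [f]. *)
  rewrite -[RHS]addr0.
  rewrite -[X in _ = _ + X](mulr0 (4 * c k ^+ 3 * (q * (1 - q) * ((1 - q) ^+ 2 - q ^+ 2)))).
  rewrite -[X in _ = _ + _ * X](bern_exp_linear s) -bern_expZ -bern_expD.
  apply: eq_bern_exp => f; have := fun b => L_setbit f b ks.
  by rewrite /L !big_cons => e; rewrite !e !setbitE/= -/q; ring.
rewrite bern_exp_linear_sqr// !big_cons -/q.
set A := (X in 3 * X ^+ 2 + _) in IHs *.
have := IHs us; rewrite -/A; set v := \sum_(_ <- _) _ ^+ 4 * _ => IH.
set B := \sum_(_ <- _) _ * (_ * _).
have BA : B <= A.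
  apply: ler_sum => j _; have /andP[? ?] := p01 j.
  by rewrite ler_wpM2l ?sqr_ge0// ler_piMr// gerBl.
have B0 : 0 <= B.
  apply: sumr_ge0 => j _; have /andP[? ?] := p01 j.
  by rewrite mulr_ge0 ?sqr_ge0// mulr_ge0// subr_ge0.
have c2 : 0 <= c k ^+ 2 by rewrite sqr_ge0.
have h1 : c k ^+ 2 * (q * (1 - q)) * B <= c k ^+ 2 * q * A.
  apply: ler_pM => //; first by rewrite mulr_ge0// mulr_ge0// subr_ge0.
  by rewrite ler_wpM2l// ler_piMr// gerBl.
have h2 : c k ^+ 4 * (q * (1 - q) * ((1 - q) ^+ 3 + q ^+ 3)) <= c k ^+ 4 * q.
  rewrite ler_wpM2l ?(exprn_even_ge0 _ (isT : ~~ odd 4))//.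
  have q1 : 0 <= q * (1 - q) <= q.
    by rewrite mulr_ge0 ?subr_ge0//= ler_piMr// gerBl.
  have -> : (1 - q) ^+ 3 + q ^+ 3 = 1 - 3 * (q * (1 - q)) by ring.
  by move: q1; nra.
have h3 : 0 <= (c k ^+ 2 * q) ^+ 2 by rewrite sqr_ge0.
have -> : 3 * (c k ^+ 2 * q + A) ^+ 2 =
    3 * A ^+ 2 + 6 * (c k ^+ 2 * q * A) + 3 * (c k ^+ 2 * q) ^+ 2 by ring.
move: h1 h2 h3 IH; nra.
Qed.

End LinearForm.

End BernoulliProduct.

(** * Moments and tail of the number of sampled wedges *)

Section WedgeSampling.
Local Open Scope set_scope.
Variables (R : realType) (V : finType) (alpha beta : R).
Implicit Types (f : {ffun hash_key V -> bool}) (w : wedge V) (e : edge V).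

Definition hash_prob (k : hash_key V) : R :=
  match k with inl _ => alpha | inr _ => beta end.

Definition sampled (f : {ffun hash_key V -> bool}) (w : wedge V) : bool :=
  [forall e in val w, f (inl e)] && f (inr w).

Lemma wedge_edges w : exists e1 e2, e1 != e2 /\ val w = [set e1; e2].
Proof.
by have /andP[/cards2P[e1 [e2 [e12 we]]] _] := valP w; exists e1, e2.
Qed.

Let A f (e : edge V) : R := (f (inl e))%:R - alpha.
Let B f (w : wedge V) : R := (f (inr w))%:R - beta.
Let AA (w : wedge V) f : R := \prod_(e in val w) A f e.
Let aB (w : wedge V) f : R := (\prod_(e in val w) (f (inl e))%:R) * B f w.

Lemma sampled_centered f w :
  (sampled f w)%:R - alpha ^+ 2 * beta =
  alpha * beta * (\sum_(e in val w) A f e) + (beta * AA w f + aB w f).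
Proof.
have [e1 [e2 [e12 we]]] := wedge_edges w.
have -> : sampled f w = [&& f (inl e1), f (inl e2) & f (inr w)].
  rewrite /sampled andbA; congr (_ && _); apply/forall_inP/andP => [h|[h1 h2] e].
    by rewrite !h// we !inE eqxx ?orbT.
  by rewrite we !inE => /orP[]/eqP->.
rewrite /AA /aB /B we !big_setU1 ?inE//= !big_set1 /A.
case: (f (inl e1)); case: (f (inl e2)); case: (f (inr w)) => /=; ring.
Qed.

Variables (S : {set wedge V}) (x gamma : R).

Let deg e : R := #|[set w in S | e \in val w]|%:R.

Lemma exchange_wedge_sum (F : edge V -> R) :
  \sum_(w in S) \sum_(e in val w) F e = \sum_e deg e * F e.
Proof.
rewrite (exchange_big_dep predT)//=; apply: eq_bigr => e _.
rewrite /deg mulr_natl -sumr_const.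
by apply: eq_bigl => w; rewrite inE.
Qed.

Lemma sum_wedge_degree : \sum_e deg e = 2 * #|S|%:R.
Proof.
under eq_bigr do rewrite -[deg _]mulr1; rewrite -exchange_wedge_sum.
rewrite mulrC -sumr_const mulr_suml; apply: eq_bigr => w _.
by have /andP[/eqP w2 _] := valP w; rewrite sumr_const w2 mul1r.
Qed.

Hypotheses (alpha01 : 0 < alpha < 1) (beta01 : 0 < beta < 1).

Lemma hash_prob01 k : 0 <= hash_prob k <= 1.
Proof.
by case: k => ? /=; [case/andP: alpha01|case/andP: beta01] => *; rewrite !ltW.
Qed.

Let Ex := bern_exp hash_prob.

(** Two distinct wedges have two edges each, so some edge of the first is not in the second; its
    centred bit occurs only once in the product and kills the cross term. A diagonal term is
    [(alpha (1 - alpha))^2]. *)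
Lemma AA_sqr_sum : Ex (fun f => (\sum_(w in S) AA w f) ^+ 2) <= alpha ^+ 2 * #|S|%:R.
Proof.
have /andP[a0 a1] := alpha01.
rewrite /Ex bern_exp_sqr_sum => [|w w' _ _ ww'].
  rewrite mulrC -sumr_const mulr_suml; apply: ler_sum => w _; rewrite mul1r.
  have [e1 [e2 [e12 we]]] := wedge_edges w.
  pose phi (b : bool) := (b%:R - alpha) ^+ 2.
  rewrite (@eq_bern_exp _ _ _ _ (fun f => phi (f (inl e1)) * (phi (f (inl e2)) * 1))).
    rewrite !bern_exp_factor ?bern_exp_cst// => [|f b]; last first.
      by rewrite setbit_neq// (inj_eq inl_inj) eq_sym.
    rewrite /phi/= mulr1 -expr2 ler_sqr ?nnegrE ?ltW//; last by nra.
    nra.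
  by move=> f; rewrite /AA we big_setU1 ?inE// big_set1 exprMn mulr1.
have [e ew ew'] : exists2 e, e \in val w & e \notin val w'.
  apply/subsetPn; apply: contra ww' => sww'; apply/eqP/val_inj/eqP.
  rewrite eqEcard sww'; have /andP[/eqP -> _] := valP w.
  by have /andP[/eqP -> _] := valP w'.
rewrite -[RHS](@bern_exp_centered _ _ hash_prob (inl e) (fun f =>
  (\prod_(e' in val w | e' != e) A f e') * AA w' f)); last first.
  move=> f b; congr (_ * _); apply: eq_bigr => e'; rewrite /A.
    by case/andP=> _ ee'; rewrite setbit_neq// (inj_eq inl_inj).
  move=> ew''; rewrite setbit_neq// (inj_eq inl_inj).
  by apply: contraNneq ew' => <-.
apply: eq_bern_exp => f; rewrite mulrA; congr (_ * _).
by rewrite /AA (bigD1 e).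
Qed.

(** Each wedge has a bit of its own, so the cross terms vanish even for wedges that share an edge
    and although the edge bits are not centred. A diagonal term is [alpha^2 beta (1 - beta)]. *)
Lemma aB_sqr_sum :
  Ex (fun f => (\sum_(w in S) aB w f) ^+ 2) <= alpha ^+ 2 * beta * #|S|%:R.
Proof.
have /andP[a0 a1] := alpha01; have /andP[b0 b1] := beta01.
rewrite /Ex bern_exp_sqr_sum => [|w w' _ _ ww'].
  rewrite mulrC -sumr_const mulr_suml; apply: ler_sum => w _; rewrite mul1r.
  have [e1 [e2 [e12 we]]] := wedge_edges w.
  pose phi (b : bool) : R := b%:R ^+ 2.
  pose psi (b : bool) := (b%:R - beta) ^+ 2.
  rewrite (@eq_bern_exp _ _ _ _ (fun f =>
    phi (f (inl e1)) * (phi (f (inl e2)) * (psi (f (inr w)) * 1)))).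
    rewrite !bern_exp_factor ?bern_exp_cst// => [|f b|f b]; last first.
    - by rewrite !setbit_neq// (inj_eq inl_inj) eq_sym.
    - by rewrite setbit_neq.
    rewrite /phi/psi/= mulr1 expr1n expr0n/= !mulr0 !addr0 !mulr1 mulrA -expr2.
    rewrite ler_wpM2l ?sqr_ge0//; nra.
  by move=> f; rewrite /aB we big_setU1 ?inE// big_set1 !exprMn mulr1 /phi /psi mulrA.
rewrite -[RHS](@bern_exp_centered _ _ hash_prob (inr w) (fun f =>
  (\prod_(e in val w) (f (inl e))%:R) * aB w' f)); last first.
  move=> f b; congr (_ * (_ * _)); try by apply: eq_bigr => e _; rewrite setbit_neq.
  by rewrite /B setbit_neq// (inj_eq inr_inj) eq_sym.
by apply: eq_bern_exp => f; rewrite [aB w f]mulrC [RHS]mulrA.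
Qed.

(** Here [x] stands for the square root of [|W_t|], while [S] may be a smaller set of wedges of
    [G_t]: deviations are measured against [|W_t|], not against the size of [S]. *)
Hypotheses (gamma0 : 0 < gamma) (x0 : 0 < x).
Hypothesis deg_le : forall e, deg e <= 3 * x.
Hypothesis S_le : #|S|%:R <= x ^+ 2.

Let L f := \sum_e deg e * A f e.

(** Since degrees are at most [3 x] and sum to at most [2 x^2], their squares sum to at most [6 x^3]
    and their fourth powers to at most [54 x^5]; then [108 = 3 * 6^2]. *)
Lemma linear_pow4 :
  Ex (fun f => L f ^+ 4) <= 108 * alpha ^+ 2 * x ^+ 6 + 54 * alpha * x ^+ 5.
Proof.
have /andP[a0 a1] := alpha01.
(* Wedge bits receive coefficient zero, which turns [L] into a linear form in all hash bits. *)
pose c (k : hash_key V) : R := if k is inl e then deg e else 0.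
have sumc (n : nat) : \sum_k c k ^+ n.+1 * hash_prob k = alpha * \sum_e deg e ^+ n.+1.
  rewrite big_sumType/= [X in _ + X]big1 ?addr0; last first.
    by move=> w _; rewrite expr0n mul0r.
  by rewrite mulr_sumr; apply: eq_bigr => e _; rewrite mulrC.
have := @bern_exp_linear_pow4 _ _ _ hash_prob01 c _ (index_enum_uniq (hash_key V)).
rewrite !sumc.
rewrite (@eq_bern_exp _ _ _ _ (fun f => L f ^+ 4)); last first.
  move=> f; rewrite big_sumType/= [X in _ + X]big1 ?addr0// => w _.
  by rewrite mul0r.
move=> /le_trans; apply.
have deg0 e : 0 <= deg e by [].
have degsum : \sum_e deg e <= 2 * x ^+ 2 by rewrite sum_wedge_degree ler_pM2l.
have degpow n : \sum_e deg e ^+ n.+1 <= (3 * x) ^+ n * (2 * x ^+ 2).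
  apply: (@le_trans _ _ (\sum_e (3 * x) ^+ n * deg e)).
    by apply: ler_sum => e _; rewrite exprSr ler_wpM2r// lerXn2r ?nnegrE// mulr_ge0 ?ltW.
  by rewrite -mulr_sumr ler_wpM2l// exprn_ge0// mulr_ge0 ?ltW.
have h2 : (alpha * \sum_e deg e ^+ 2) ^+ 2 <= (alpha * ((3 * x) ^+ 1 * (2 * x ^+ 2))) ^+ 2.
  rewrite lerXn2r ?nnegrE ?ler_pM2l//.
    by apply: mulr_ge0; [exact: ltW|apply: sumr_ge0 => e _; rewrite sqr_ge0].
  by rewrite !mulr_ge0 ?sqr_ge0 ?expr1 ?mulr_ge0 ?ltW.
have h4 : alpha * \sum_e deg e ^+ 4 <= alpha * ((3 * x) ^+ 3 * (2 * x ^+ 2)).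
  by rewrite ler_pM2l.
lra.
Qed.

Hypothesis gamma_small : gamma < 4000^-1.
Hypothesis sample_large : gamma ^- 6 <= alpha ^+ 2 * beta * x ^+ 2.

Lemma wedge_sample_sum f :
  \sum_(w in S) (sampled f w)%:R - alpha ^+ 2 * beta * #|S|%:R =
  alpha * beta * L f + (beta * (\sum_(w in S) AA w f) + \sum_(w in S) aB w f).
Proof.
rewrite mulrC -sumr_const mulr_suml -sumrB.
under eq_bigr do rewrite mul1r sampled_centered.
by rewrite !big_split/= -!mulr_sumr exchange_wedge_sum.
Qed.

(** The left side is what Markov's inequality gives for the fourth moment of the linear part and the
    second moment of the rest, each at half the threshold. With [z = alpha^2 beta x^2] and
    [y = alpha x], one has [z <= y^2], so [1/z <= gamma^6] and [1/y <= gamma^3]. The total is at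
    most [gamma (1728 + 864 + 16) gamma], and [2608 < 4000]. *)
Lemma moment_bounds_small :
  (2 / (alpha * gamma * x ^+ 2)) ^+ 4 *
    (108 * alpha ^+ 2 * x ^+ 6 + 54 * alpha * x ^+ 5) +
  (2 / (alpha ^+ 2 * beta * gamma * x ^+ 2)) ^+ 2 *
    (2 * beta ^+ 2 * (alpha ^+ 2 * x ^+ 2) + 2 * (alpha ^+ 2 * beta * x ^+ 2))
  < gamma.
Proof.
have /andP[a0 a1] := alpha01; have /andP[b0 b1] := beta01.
pose z := alpha ^+ 2 * beta * x ^+ 2; pose y := alpha * x.
have z0 : 0 < z by rewrite !mulr_gt0 ?exprn_gt0.
have y0 : 0 < y by rewrite mulr_gt0.
have zV : z^-1 <= gamma ^+ 6.
  by rewrite -[leRHS]invrK lef_pV2 ?posrE ?invr_gt0 ?exprn_gt0.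
have yV : y^-1 <= gamma ^+ 3.
  rewrite -ler_sqr ?nnegrE ?invr_ge0 ?exprn_ge0 ?(ltW y0) ?(ltW gamma0)//.
  rewrite -exprM; apply: le_trans zV; rewrite exprVn lef_pV2 ?posrE ?exprn_gt0//.
  by rewrite /y /z exprMn -mulrA mulrCA ler_piMl ?mulr_ge0 ?sqr_ge0 ?ltW.
have -> : (2 / (alpha * gamma * x ^+ 2)) ^+ 4 *
    (108 * alpha ^+ 2 * x ^+ 6 + 54 * alpha * x ^+ 5) =
    (1728 * y^-1 ^+ 2 + 864 * y^-1 ^+ 3) * gamma ^- 4.
  by rewrite /y; field; rewrite !gt_eqF.
have h2 : (2 / (alpha ^+ 2 * beta * gamma * x ^+ 2)) ^+ 2 *
    (2 * beta ^+ 2 * (alpha ^+ 2 * x ^+ 2) + 2 * (alpha ^+ 2 * beta * x ^+ 2)) <=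
    16 * z^-1 * gamma ^- 2.
  have -> : 16 * z^-1 * gamma ^- 2 = (2 / (alpha ^+ 2 * beta * gamma * x ^+ 2)) ^+ 2 * (4 * z).
    by rewrite /z; field; rewrite !gt_eqF.
  rewrite ler_wpM2l ?sqr_ge0//.
  have -> : 2 * beta ^+ 2 * (alpha ^+ 2 * x ^+ 2) = 2 * (beta * z) by rewrite /z; ring.
  have : beta * z <= z by rewrite ler_piMl ?ltW.
  rewrite -/z; lra.
have h1 : (1728 * y^-1 ^+ 2 + 864 * y^-1 ^+ 3) * gamma ^- 4 <=
    (1728 * (gamma ^+ 3) ^+ 2 + 864 * (gamma ^+ 3) ^+ 3) * gamma ^- 4.
  rewrite ler_wpM2r ?invr_ge0 ?exprn_ge0 ?(ltW gamma0)//.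
  have yVn n : y^-1 ^+ n <= (gamma ^+ 3) ^+ n.
    by rewrite lerXn2r// nnegrE ?invr_ge0 ?exprn_ge0 ?(ltW y0) ?(ltW gamma0).
  by apply: lerD; apply: ler_wpM2l (ler0n _ _) _ _ (yVn _).
have h3 : 16 * z^-1 * gamma ^- 2 <= 16 * gamma ^+ 6 * gamma ^- 2.
  by rewrite ler_wpM2r ?invr_ge0 ?exprn_ge0 ?(ltW gamma0)// ler_wpM2l.
apply: (le_lt_trans (lerD (h1) (le_trans h2 h3))).
have -> : (1728 * (gamma ^+ 3) ^+ 2 + 864 * (gamma ^+ 3) ^+ 3) * gamma ^- 4
    + 16 * gamma ^+ 6 * gamma ^- 2
   = gamma * (1728 * gamma + 864 * gamma ^+ 4 + 16 * gamma ^+ 3).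
  by field; rewrite !gt_eqF.
have g1 : gamma < 1 by move: gamma_small; lra.
have p (n : nat) : gamma ^+ n.+1 <= gamma by rewrite exprS ler_piMr ?exprn_ile1 ?ltW.
rewrite -[ltRHS]mulr1 (ltr_pM2l gamma0).
have := p 3%N; have := p 2%N; move: gamma_small; lra.
Qed.

(* The linear part of the deviation is controlled by its fourth moment: its
   variance is of order [gamma ^+ 3 * x ^+ 4], so Chebyshev alone would only
   give a constant multiple of [gamma]. *)
Lemma wedge_sample_tail :
  Ex (fun f => (gamma * x ^+ 2 <
    `|(alpha ^+ 2 * beta)^-1 * (\sum_(w in S) (sampled f w)%:R) - #|S|%:R|)%R%:R)
  < gamma.
Proof.
have /andP[a0 a1] := alpha01; have /andP[b0 b1] := beta01.
pose q := alpha ^+ 2 * beta.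
have q0 : 0 < q by rewrite mulr_gt0 ?exprn_gt0.
apply: le_lt_trans moment_bounds_small.
set a4 := (2 / _) ^+ 4; set a2 := (2 / _) ^+ 2.
have a40 : 0 <= a4 by rewrite exprn_even_ge0.
have a20 : 0 <= a2 by rewrite sqr_ge0.
pose Q1 f := \sum_(w in S) AA w f; pose Q2 f := \sum_(w in S) aB w f.
(* The indicator of a large deviation is majorized pointwise by this polynomial, which is Markov's
   inequality for both parts at once. *)
apply: (@le_trans _ _ (Ex (fun f => a4 * L f ^+ 4 +
    a2 * (2 * beta ^+ 2 * Q1 f ^+ 2 + 2 * Q2 f ^+ 2)))); last first.
  rewrite /Ex bern_expD !bern_expZ bern_expD !bern_expZ; apply: lerD.
    by apply: (ler_wpM2l a40); exact: linear_pow4.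
  apply: (ler_wpM2l a20); apply: lerD; apply: ler_wpM2l => //.
  - by rewrite mulr_ge0 ?sqr_ge0.
  - by apply: le_trans AA_sqr_sum _; rewrite ler_wpM2l ?sqr_ge0.
  - by apply: le_trans aB_sqr_sum _; rewrite ler_wpM2l// ltW.
apply: le_bern_exp; first exact: hash_prob01.
move=> f; have := wedge_sample_sum f; rewrite -/q -/(Q1 f) -/(Q2 f).
set X := \sum_(w in S) _ => EX.
set l := L f in EX *; set u := Q1 f in EX *; set v := Q2 f in EX *.
have l4 : 0 <= l ^+ 4 by rewrite exprn_even_ge0.
have r1 : 0 <= 2 * beta ^+ 2 * u ^+ 2 + 2 * v ^+ 2.
  by apply: addr_ge0; apply: mulr_ge0; rewrite ?sqr_ge0// mulr_ge0 ?sqr_ge0.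
have r0 : 0 <= a4 * l ^+ 4 + a2 * (2 * beta ^+ 2 * u ^+ 2 + 2 * v ^+ 2).
  by apply: addr_ge0; apply: mulr_ge0.
case: ltP => //= dev.
have {}dev : q * gamma * x ^+ 2 < `|alpha * beta * l| + `|beta * u + v|.
  apply: lt_le_trans (ler_normD _ _); rewrite -EX.
  have -> : X - q * #|S|%:R = q * (q^-1 * X - #|S|%:R) by field; rewrite gt_eqF.
  by rewrite normrM (gtr0_norm q0) -mulrA ltr_pM2l.
(* One of the two parts reaches half the threshold. For the linear part a factor [alpha * beta]
   cancels, which leaves only [alpha] in the denominator of [a4]. *)
have [hl|hl] := leP (q * gamma * x ^+ 2 / 2) `|alpha * beta * l|.
  have h : 1 <= (2 / (alpha * gamma * x ^+ 2)) * `|l|.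
    rewrite mulrAC ler_pdivlMr ?mulr_gt0 ?exprn_gt0// mul1r.
    rewrite normrM gtr0_norm ?mulr_gt0// in hl.
    rewrite -(ler_pM2l (mulr_gt0 a0 b0)); move: hl; rewrite /q; lra.
  apply: (@le_trans _ _ (a4 * l ^+ 4)); last first.
    by rewrite lerDl mulr_ge0.
  by rewrite -(ger0_norm l4) normrX /a4 -exprMn exprn_ege1.
have h : 1 <= (2 / (q * gamma * x ^+ 2)) * `|beta * u + v|.
  rewrite mulrAC ler_pdivlMr ?mulr_gt0 ?exprn_gt0// mul1r.
  move: hl dev; lra.
apply: (@le_trans _ _ (a2 * (beta * u + v) ^+ 2)).
  by rewrite -(real_normK (num_real (beta * u + v))) /a2 -exprMn exprn_ege1.
apply: (@le_trans _ _ (a2 * (2 * beta ^+ 2 * u ^+ 2 + 2 * v ^+ 2))); last first.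
  by rewrite lerDr mulr_ge0.
rewrite ler_wpM2l//; have := sqr_ge0 (beta * u - v); nra.
Qed.

End WedgeSampling.

(** * Wedges, triangles and the number of wedges through an edge *)

Section WedgeGeometry.
Local Open Scope set_scope.
Variable V : finType.
Implicit Types (w : wedge V) (e c : edge V) (s : {set V}).

Definition wedge_span (w : wedge V) : {set V} := \bigcup_(e in val w) val e.

Lemma edge_other_end e u : u \in val e -> exists2 v, v != u & val e = [set u; v].
Proof.
have /cards2P[a [b [ab ->]]] := valP e; rewrite !inE => /orP[]/eqP->.
  by exists b => //; rewrite eq_sym.
by exists a => //; rewrite finset.setUC.
Qed.

Lemma wedge_shape w : exists u v z e1 e2,
  [/\ [/\ v != u, z != u & v != z], val w = [set e1; e2], e1 != e2,
      val e1 = [set u; v] & val e2 = [set u; z]].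
Proof.
have /andP[/cards2P[e1 [e2 [e12 we]]] /cards1P[u]] := valP w.
rewrite /wedge_center we big_setU1 ?inE// big_set1 => cu.
have : u \in val e1 :&: val e2 by rewrite cu inE.
rewrite inE => /andP[/edge_other_end[v vu e1E] /edge_other_end[z zu e2E]].
exists u, v, z, e1, e2; split => //; split => //.
by apply: contraNneq e12 => vz; apply/eqP/val_inj; rewrite e1E e2E vz.
Qed.

Lemma wedge_spanE w e1 e2 : e1 != e2 -> val w = [set e1; e2] ->
  wedge_span w = val e1 :|: val e2.
Proof. by move=> e12 we; rewrite /wedge_span we big_setU1 ?inE// big_set1. Qed.

Lemma wedge_centerE w e1 e2 : e1 != e2 -> val w = [set e1; e2] ->
  wedge_center (val w) = val e1 :&: val e2.
Proof. by move=> e12 we; rewrite /wedge_center we big_setU1 ?inE// big_set1. Qed.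

Lemma closing_edge_shape w u v z e1 e2 c :
  [/\ v != u, z != u & v != z] -> val w = [set e1; e2] -> e1 != e2 ->
  val e1 = [set u; v] -> val e2 = [set u; z] ->
  closing_edge w c = (val c == [set v; z]).
Proof.
move=> [vu zu vz] we e12 e1E e2E.
rewrite /closing_edge -/(wedge_span w) (wedge_spanE e12 we) (wedge_centerE e12 we).
rewrite e1E e2E; congr (_ == _); apply/setP => a; rewrite !inE.
have [->|au] := eqVneq a u; first by rewrite eq_sym (negbTE vu) eq_sym (negbTE zu).
have [->|av] := eqVneq a v; first by rewrite (negbTE vz).
by case: (a == z).
Qed.

Lemma closing_edge_exists w : exists c, closing_edge w c.
Proof.
have [u [v [z [e1 [e2 [uvz we e12 e1E e2E]]]]]] := wedge_shape w.
have vz : #|[set v; z]| == 2%N by case: uvz => _ _; rewrite cards2 => ->.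
by exists (exist (fun e : {set V} => #|e| == 2%N) _ vz);
  rewrite (closing_edge_shape _ uvz we e12 e1E e2E).
Qed.

Lemma closing_edge_uniq w c e : closing_edge w c -> closing_edge w e = (e == c).
Proof. by rewrite /closing_edge => /eqP <-; rewrite (inj_eq val_inj). Qed.

Lemma closing_edge_notin w c : closing_edge w c -> c \notin val w.
Proof.
have [u [v [z [e1 [e2 [[vu zu vz] we e12 e1E e2E]]]]]] := wedge_shape w.
rewrite (@closing_edge_shape w u v z e1 e2)// => /eqP cE; rewrite we !inE.
have uc : u \notin val c by rewrite cE !inE negb_or eq_sym vu eq_sym zu.
by apply/norP; split; apply: contraNneq uc => ->; rewrite ?e1E ?e2E !inE eqxx.
Qed.

Lemma card_wedge_span w : #|wedge_span w| = 3%N.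
Proof.
have [u [v [z [e1 [e2 [[vu zu vz] we e12 e1E e2E]]]]]] := wedge_shape w.
rewrite (wedge_spanE e12 we) e1E e2E.
rewrite -finset.setUA (finset.setUCA [set v]) finset.setUA finset.setUid.
by rewrite cardsU1 cards2 vz !inE negb_or eq_sym vu eq_sym zu.
Qed.

(** Three vertices carry only three pairs. Hence the triangle on the span of [w] is present exactly
    when [c] and both edges of [w] are. *)
Lemma sub_wedge_span w c e : closing_edge w c ->
  (val e \subset wedge_span w) = (e \in c |: val w).
Proof.
have [u [v [z [e1 [e2 [[vu zu vz] we e12 e1E e2E]]]]]] := wedge_shape w.
rewrite (@closing_edge_shape w u v z e1 e2)// => /eqP cE.
rewrite (wedge_spanE e12 we) we !inE; apply/idP/idP; last first.
  case/or3P=> /eqP ->; rewrite ?finset.subsetUl ?finset.subsetUr// cE e1E e2E.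
  by apply/fintype.subsetP => a; rewrite !inE => /orP[]/eqP->; rewrite eqxx !orbT.
have /cards2P[a [b [ab eE]]] := valP e.
move=> /fintype.subsetP sub; have := sub a; have := sub b.
rewrite eE e1E e2E !inE !eqxx orbT/= => /(_ isT) hb /(_ isT) ha.
rewrite -!(inj_eq val_inj) eE cE e1E e2E.
have {}ha : [|| a == u, a == v | a == z] by case/orP: ha => /orP[]->; rewrite ?orbT.
have {}hb : [|| b == u, b == v | b == z] by case/orP: hb => /orP[]->; rewrite ?orbT.
case/or3P: ha => /eqP ha; case/or3P: hb => /eqP hb; move: ab; rewrite ha hb ?eqxx// => _;
  by rewrite ?eqxx ?orbT// finset.setUC eqxx ?orbT.
Qed.

(** The wedge is centred at the vertex of [s] outside [c] and joins it to both ends of [c]. *)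
Lemma triangle_wedge s c : #|s| = 3%N -> val c \subset s ->
  exists2 w, wedge_span w = s & closing_edge w c.
Proof.
move=> s3 cs; have /cards2P[v [z [vz cE]]] := valP c.
have /eqP/cards1P[u uE] : #|s :\: val c| = 1%N.
  by rewrite cardsD (finset.setIidPr cs) s3; have /eqP -> := valP c.
have : u \in s :\: val c by rewrite uE inE.
rewrite inE cE !inE negb_or => /andP[/andP[uv uz] us].
have uv2 : #|[set u; v]| == 2%N by rewrite cards2 uv.
have uz2 : #|[set u; z]| == 2%N by rewrite cards2 uz.
pose e1 : edge V := exist (fun e : {set V} => #|e| == 2%N) _ uv2.
pose e2 : edge V := exist (fun e : {set V} => #|e| == 2%N) _ uz2.
have e12 : e1 != e2.
  apply/eqP => /(congr1 val)/= /setP/(_ v); rewrite !inE eqxx orbT.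
  by rewrite (negbTE vz) orbF eq_sym (negbTE uv).
have ww : is_wedge [set e1; e2].
  rewrite /is_wedge cards2 e12 /wedge_center big_setU1 ?inE//= big_set1/=.
  have -> : [set u; v] :&: [set u; z] = [set u].
    apply/setP => a; rewrite !inE; have [->|] := eqVneq a u => //= _.
    by have [->|] := eqVneq a v; rewrite ?(negbTE vz).
  by rewrite cards1.
pose w : wedge V := exist (fun X => is_wedge X) _ ww.
exists w; last first.
  by rewrite (@closing_edge_shape w u v z e1 e2) ?cE//; split => //; rewrite eq_sym.
rewrite (@wedge_spanE w e1 e2)//=.
apply/setP => a; move/setP/(_ a): uE; move/fintype.subsetP/(_ a): cs.
rewrite cE !inE.
have [->|au] := eqVneq a u; first by rewrite us.
have [->|av] := eqVneq a v; first by move=> ->.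
have [->|az] := eqVneq a z; first by move=> ->.
by move=> _ /= ->.
Qed.

(** Two distinct edges at [u] have different other ends, so they meet only in [u] and form a
    wedge. *)
Lemma star_wedges (E : {set edge V}) u :
  ('C(#|[set e in E | u \in val e]|, 2) <= #|[set w : wedge V | val w \subset E]|)%N.
Proof.
rewrite -cards_draws -[leqRHS](card_imset _ val_inj); apply: subset_leq_card.
apply/fintype.subsetP => X; rewrite inE => /andP[XE /cards2P[e1 [e2 [e12 XE']]]].
have [/andP[e1E ue1] /andP[e2E ue2]] :
    (e1 \in E) && (u \in val e1) /\ (e2 \in E) && (u \in val e2).
  by split; have := fintype.subsetP XE; [move/(_ e1)|move/(_ e2)];
    rewrite XE' !inE eqxx ?orbT => /(_ isT).
have wX : is_wedge X.
  rewrite /is_wedge XE' cards2 e12 /wedge_center big_setU1 ?inE//= big_set1.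
  have [v vu e1v] := edge_other_end ue1; have [z zu e2z] := edge_other_end ue2.
  have vz : v != z by apply: contraNneq e12 => vz; apply/eqP/val_inj; rewrite e1v e2z vz.
  apply/cards1P; exists u; rewrite e1v e2z.
  apply/setP => a; rewrite !inE; have [->|] := eqVneq a u => //= _.
  by have [->|] := eqVneq a v; rewrite ?(negbTE vz).
apply/imsetP; exists (exist (fun X => is_wedge X) _ wX) => //; rewrite inE /= XE'.
by apply/fintype.subsetP => e; rewrite !inE => /orP[]/eqP->.
Qed.

(** A wedge through [e] is determined by its other edge, which lies in the star of an end of [e]. If
    an end has [d] further edges, [star_wedges] gives [d^2 <= d (d + 1) <= 2 N]; the sum of two such
    numbers has square at most [2 (2 N + 2 N)]. *)
Lemma incident_wedges (E : {set edge V}) e :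
  (#|[set w : wedge V | (val w \subset E) && (e \in val w)]| ^ 2 <=
   8 * #|[set w : wedge V | val w \subset E]|)%N.
Proof.
set N := #|[set w : wedge V | val w \subset E]|.
have [eE|eE] := boolP (e \in E); last first.
  rewrite (_ : [set w | _] = finset.set0) ?cards0//; apply/setP => w; rewrite !inE.
  by apply/negbTE/negP => /andP[/fintype.subsetP wE /wE]; rewrite (negbTE eE).
have /cards2P[u [v [uv euv]]] := valP e.
pose St a := [set f in E | a \in val f] :\ e.
have Sq a : a \in val e -> (#|St a| ^ 2 <= 2 * N)%N.
  move=> ae; have := star_wedges E a; rewrite -/N (cardsD1 e) inE eE ae/= -/(St a).
  move=> h; rewrite add1n in h; have := leq_mul (leqnn 2) h; apply: leq_trans.
  by rewrite -mul_bin_diag bin1 -mulnn leq_mul2r leqnSn orbT.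
pose D := [set w : wedge V | (val w \subset E) && (e \in val w)].
have le : (#|D| <= #|St u| + #|St v|)%N.
  have inj : {in D &, injective (fun w : wedge V => val w :\ e)}.
    move=> w w'; rewrite !inE => /andP[_ ew] /andP[_ ew'] h; apply: val_inj.
    by rewrite -(finset.setD1K ew) -(finset.setD1K ew') h.
  rewrite -(card_in_imset inj).
  apply: (@leq_trans #|[set [set f] | f in St u :|: St v]|); last first.
    by rewrite card_imset ?cardsU ?leq_subr//; exact: set1_inj.
  apply: subset_leq_card; apply/fintype.subsetP => X /imsetP[w wD ->].
  move: wD; rewrite inE => /andP[/fintype.subsetP wE ew].
  have /andP[/eqP w2 /cards1P[a aE]] := valP w.
  have : #|val w :\ e| == 1%N.
    by rewrite -(eqn_add2l 1) -[X in _ == X]w2 [X in _ == X](cardsD1 e) ew.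
  case/cards1P=> f fE; rewrite fE; apply: imset_f.
  have : f \in val w :\ e by rewrite fE inE.
  rewrite 2!inE => /andP[fe fw].
  have aw g : g \in val w -> a \in val g.
    have : a \in wedge_center (val w) by rewrite aE inE.
    by move=> /bigcapP h /h.
  have := aw _ ew; have := aw _ fw; rewrite euv !inE fe (wE _ fw)/=.
  by move=> af /orP[]/eqP <-; rewrite af ?orbT.
have uS : (#|St u| ^ 2 <= 2 * N)%N by apply: Sq; rewrite euv !inE eqxx.
have vS : (#|St v| ^ 2 <= 2 * N)%N by apply: Sq; rewrite euv !inE eqxx orbT.
apply: (@leq_trans ((#|St u| + #|St v|) ^ 2)); first by rewrite leq_sqr.
rewrite sqrnD; apply: (leq_trans (leq_add (leqnn _) (nat_Cauchy _ _).1)).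
by rewrite addnn -mul2n (leq_trans (leq_mul (leqnn 2) (leq_add uS vS)))// -mulnDl mulnA.
Qed.

End WedgeGeometry.

(** * The closing bit and the triangles of the window *)

Section ClosedWedges.
Local Open Scope set_scope.
Variable V : finType.
Implicit Types (w : wedge V) (e c : edge V) (l : seq (edge V)).

(** This follows [w] from the start of the stream instead of from its insertion. The result is the
    same, since [w] is inserted at an arrival of one of its own edges, which resets the bit
    anyway. *)
Definition closed_bit (w : wedge V) (l : seq (edge V)) : bool :=
  foldl (fun b e => if closing_edge w e then true
                    else if e \in val w then false else b) false l.

(* [index e (rev l)] is small when the last occurrence of [e] in [l] is recent. *)
Lemma closed_bitE w c l : closing_edge w c ->
  closed_bit w l = [forall e in val w, (index c (rev l) < index e (rev l))%N].
Proof.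
move=> wc; have cw := closing_edge_notin wc.
elim/last_ind: l => [|l a IHl].
  have [e1 [e2 [_ we]]] := wedge_edges w.
  by apply/esym/forall_inP => /(_ e1); rewrite we !inE eqxx => /(_ isT).
rewrite /closed_bit foldl_rcons -/(closed_bit w l) (closing_edge_uniq _ wc) rev_rcons.
case: eqP => [->|/eqP ac] /=.
  rewrite eqxx; apply/esym/forall_inP => e ew.
  by case: eqP => // ce; rewrite ce ew in cw.
rewrite (negbTE ac); case: ifP => aw.
  by apply/esym/forall_inP => /(_ _ aw); rewrite eqxx.
rewrite IHl; apply: eq_forallb_in => e ew.
by case: eqP => // ae; rewrite ae ew in aw.
Qed.

(** An edge belongs to the window exactly when its last occurrence does, so the window becomes a
    bound on the position counted from the end. *)
Lemma mem_drop_index l k e : (e \in drop k l) = (index e (rev l) < size l - k)%N.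
Proof. by rewrite -mem_rev rev_drop in_take_leq// size_rev leq_subr. Qed.

Variables (es : seq (edge V)) (Dt t : nat).

Definition closed_wedges : {set wedge V} :=
  [set w in W_ es Dt t | closed_bit w (take t es)].

(* In a triangle of [G_t] exactly one wedge has its closing edge seen last. *)
Lemma card_closed_wedges : #|closed_wedges| = #|T_ es Dt t|.
Proof.
set l := take t es; pose pos e := index e (rev l).
have memE e : (e \in E_ es Dt t) = (pos e < size l - (maxn 1 (t - Dt)).-1)%N.
  by rewrite inE mem_drop_index.
have closedP w c : closing_edge w c -> w \in closed_wedges ->
    forall e, e \in val w -> (pos c < pos e)%N.
  by move=> wc; rewrite inE (closed_bitE _ wc) => /andP[_ /forall_inP].
have <- : (@wedge_span V) @: closed_wedges = T_ es Dt t.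
  apply/setP => s; apply/imsetP/idP => [[w wS ->]|].
    have [c wc] := closing_edge_exists w.
    rewrite inE card_wedge_span eqxx; apply/forall_inP => e.
    rewrite (sub_wedge_span _ wc).
    have wE : val w \subset E_ es Dt t by move: wS; rewrite !inE => /andP[].
    case/setU1P=> [->|]; last exact: (fintype.subsetP wE).
    have [e1 [e2 [_ we]]] := wedge_edges w.
    have e1w : e1 \in val w by rewrite we !inE eqxx.
    (* The closing edge is more recent than an edge of the window, hence lies in the window too; the
       bit itself need not know [Dt]. *)
    rewrite memE (ltn_trans (closedP _ _ wc wS _ e1w))// -memE.
    exact: (fintype.subsetP wE).
  rewrite inE => /andP[/eqP s3 /forall_inP sE].
  have [e0 e0s] : exists e : edge V, val e \subset s.
    have /card_gt1P[a [b [sa sb ab]]] : (1 < #|s|)%N by rewrite s3.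
    have ab2 : #|[set a; b]| == 2%N by rewrite cards2 ab.
    exists (exist (fun e : {set V} => #|e| == 2%N) _ ab2) => /=.
    by apply/fintype.subsetP => ?; rewrite !inE => /orP[]/eqP->.
  (* The edge [c] of the triangle seen most recently is the closing edge of the wanted wedge. *)
  case: (@arg_minnP _ e0 (fun e => val e \subset s) pos e0s) => c cs cmin.
  have [w ws wc] := triangle_wedge s3 cs.
  have sub e : e \in val w -> val e \subset s.
    by move=> ew; rewrite -ws (sub_wedge_span _ wc) inE ew orbT.
  exists w => //; rewrite !inE (closed_bitE _ wc); apply/andP; split.
    by apply/fintype.subsetP => e /sub /sE.
  apply/forall_inP => e ew; rewrite ltn_neqAle cmin ?sub// andbT.
  apply/negP => /eqP ce; have := closing_edge_notin wc.
  have inl e' : val e' \subset s -> e' \in rev l.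
    by move=> /sE; rewrite inE mem_rev => /mem_drop.
  by rewrite -(nth_index c (inl _ cs)) ce nth_index ?ew// inl// sub.
rewrite card_in_imset// => w w' wS w'S ss.
have [c wc] := closing_edge_exists w; have [c' wc'] := closing_edge_exists w'.
have eqU : c |: val w = c' |: val w'.
  by apply/setP => e; rewrite -(sub_wedge_span e wc) ss (sub_wedge_span e wc').
(* If two closed wedges of one triangle had different closing edges, each closing edge would belong
   to the other wedge, and each would be more recent than the other. *)
have cc : c = c'.
  apply/eqP; apply: contraT => ncc.
  have cw' : c \in val w'.
    by have := setU11 c (val w); rewrite eqU !inE (negbTE ncc).
  have cw : c' \in val w.
    by have := setU11 c' (val w'); rewrite -eqU !inE eq_sym (negbTE ncc).
  by have := ltn_trans (closedP _ _ wc wS _ cw) (closedP _ _ wc' w'S _ cw'); rewrite ltnn.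
apply: val_inj; rewrite -(finset.setU1K (closing_edge_notin wc)) eqU cc.
by rewrite finset.setU1K// closing_edge_notin.
Qed.

End ClosedWedges.

(** * The state of the algorithm in terms of the hash bits *)

Section MGRun.
Local Open Scope set_scope.
Variables (R : realType) (V : finType) (alpha beta : R) (h : hash_key V -> R).
Implicit Types (w : wedge V) (l : seq (edge V)).

Definition hash_bits : {ffun hash_key V -> bool} :=
  [ffun k => h k <= hash_prob alpha beta k].

(** A wedge is tested when the second of its edges enters the edge list, and later arrivals of kept
    edges change neither list. So both lists depend only on which edges were seen and on the bits,
    not on order or multiplicity. *)
Lemma mg_foldl_invariant l :
  let s := foldl (mg_step alpha beta h) (mg_init V) l in
  [/\ e_list s = [set e | (e \in l) && hash_bits (inl e)],
      w_list s = [set w : wedge V | (val w \subset e_list s) && hash_bits (inr w)]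
    & forall w, w \in w_list s -> x_bit s w = closed_bit w l].
Proof.
elim/last_ind: l => [|l a]/=.
  split; [by apply/setP => e; rewrite !inE| |by move=> w; rewrite inE].
  (* A wedge has a nonempty edge set, so none is contained in the empty edge list. *)
  apply/setP => w; rewrite !inE; apply/esym/negbTE; rewrite negb_and.
  have [e1 [e2 [_ we]]] := wedge_edges w.
  by rewrite finset.subset0 we -card_gt0 cardsU1 cards1 addnS.
rewrite foldl_rcons; set s := foldl _ _ l => -[eE wE xE].
have fa : hash_bits (inl a) = (h (inl a) <= alpha) by rewrite ffunE.
have bitS w : closed_bit w (rcons l a) = if closing_edge w a then true
    else if a \in val w then false else closed_bit w l.
  by rewrite /closed_bit foldl_rcons.
rewrite /mg_step /mg_update; case: ifPn => [/andP[ha aS]|haS]; rewrite /mg_refresh/=.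
  (* The test that [w] is not yet listed is automatic: a wedge through [a] cannot be listed before
     [a] is kept. *)
  have newE w : (w \in [set w : wedge V |
      [&& [exists e in a |: e_list s, val w == [set e; a]], h (inr w) <= beta & w \notin w_list s]])
      = [&& a \in val w, val w \subset a |: e_list s & hash_bits (inr w)].
    rewrite inE [hash_bits _]ffunE /=; case hw: (h (inr w) <= beta); rewrite ?andbF//= !andbT.
    apply/andP/andP => [[/exists_inP[e ee /eqP we] _]|[aw sw]].
      rewrite we !inE eqxx orbT; split => //.
      by apply/fintype.subsetP => f; rewrite !inE => /orP[]/eqP->;
        rewrite ?eqxx//; move: ee; rewrite !inE.
    split; last first.
      rewrite wE inE negb_and; apply/orP; left.
      by apply: contra aS => /fintype.subsetP/(_ _ aw).
    have [e1 [e2 [_ we]]] := wedge_edges w.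
    apply/exists_inP; have := aw; rewrite we !inE => /orP[]/eqP ae.
      exists e2; last by rewrite finset.setUC ae.
      by apply: (fintype.subsetP sw); rewrite we !inE eqxx orbT.
    exists e1; last by rewrite ae.
    by apply: (fintype.subsetP sw); rewrite we !inE eqxx.
  split.
  - apply/setP => e; rewrite eE !inE mem_rcons inE.
    by case: (eqVneq e a) => // ->; rewrite fa ha.
  - apply/setP => w; rewrite inE newE wE !inE.
    case: (hash_bits (inr w)); rewrite ?andbF//= !andbT.
    apply/orP/idP => [[sw|/andP[]//]|sw].
      exact: fintype.subset_trans sw (finset.subsetUr _ _).
    have [aw|aw] := boolP (a \in val w); first by right.
    left; apply/fintype.subsetP => f fw; have := fintype.subsetP sw _ fw.
    by rewrite !inE => /orP[/eqP fa'|//]; rewrite -fa' fw in aw.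
  (* A wedge inserted now contains [a]; in the remaining case [a] is not in [w], so [w] was listed
     before and keeps its bit. *)
  - move=> w wl; rewrite wl bitS newE; case: ifP => // _; case: ifP => // aw /=.
    by rewrite aw /=; apply: xE; move: wl; rewrite finset.inE newE aw orbF.
split.
- apply/setP => e; rewrite eE !inE mem_rcons inE.
  case: (eqVneq e a) => // ->; rewrite fa; move: haS; rewrite eE !inE fa.
  by case: (h _ <= _) => //=; rewrite ?andbF// negbK andbT => ->.
- by [].
- by move=> w wl; rewrite wl bitS xE.
Qed.

Variables (es : seq (edge V)) (Dt t : nat).

(** Both edges of a wedge of [G_t] have been seen, so only the three bits remain to be tested. *)
Lemma live_wedgesE :
  live_wedges alpha beta h es Dt t = [set w in W_ es Dt t | sampled hash_bits w].
Proof.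
have [eE wE _] := mg_foldl_invariant (take t es).
apply/setP => w; rewrite /live_wedges /mg_run wE eE 2!inE andbC [in RHS]inE.
have [|//] := boolP (w \in W_ es Dt t); rewrite inE => /fintype.subsetP wW.
rewrite /= /sampled; congr (_ && _); apply/fintype.subsetP/forall_inP => [wl e /wl|wl e ew].
  by rewrite inE => /andP[].
by rewrite inE wl// andbT; have := wW _ ew; rewrite inE => /mem_drop.
Qed.

Lemma W_hatE : W_hat alpha beta h es Dt t =
  (alpha ^+ 2 * beta)^-1 * \sum_(w in W_ es Dt t) (sampled hash_bits w)%:R.
Proof.
rewrite /W_hat live_wedgesE -sum1_card natr_sum; congr (_ * _).
rewrite [RHS]big_mkcond [LHS]big_mkcond; apply: eq_bigr => w _.
by rewrite inE; case: (w \in W_ _ _ _) => //=; case: sampled.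
Qed.

Lemma T_hatE : T_hat alpha beta h es Dt t =
  (alpha ^+ 2 * beta)^-1 * \sum_(w in closed_wedges es Dt t) (sampled hash_bits w)%:R.
Proof.
rewrite /T_hat; congr (_ * _); rewrite [RHS]big_mkcond [LHS]big_mkcond.
apply: eq_bigr => w _; rewrite live_wedgesE [in LHS]inE [in RHS]inE.
case: ifP => [/andP[wW fw]|]; last first.
  by case: (w \in W_ _ _ _) => //= ->; case: ifP.
rewrite wW fw /=; have [_ _ ->] := mg_foldl_invariant (take t es); first by case: closed_bit.
have : w \in live_wedges alpha beta h es Dt t by rewrite live_wedgesE inE wW fw.
by rewrite inE => /andP[].
Qed.

End MGRun.

(** * From independent uniform hashes to the product Bernoulli law *)

Section IndependentThresholds.
Variables (R : realType) (d : measure_display) (Omega : measurableType d).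
Variables (P : probability Omega R) (K : finType) (X : K -> {RV P >-> R}).
Variable p : K -> R.
Hypotheses (indX : mutually_independent X) (unifX : forall k, uniform01 (X k)).
Hypothesis p01 : forall k, 0 <= p k <= 1.

Let bits (omega : Omega) : {ffun K -> bool} := [ffun k => X k omega <= p k].

Let below k : P (X k @^-1` `]-oo, p k]) = (p k)%:E.
Proof.
have /andP[p0 p1] := p01 k.
have := unifX k (measurable_itv `]-oo, p k]%R).
rewrite /distribution /pushforward => ->.
rewrite /uniform_prob integral_uniform_pdf.
have -> : `]-oo, p k] `&` `[0, 1] = `[0, p k]%classic.
  apply/seteqP; split => x /=; rewrite !in_itv/=.
    by move=> [-> /andP[->]].
  by move=> /andP[x0 xp]; rewrite xp x0 (le_trans xp p1).
rewrite (eq_integral (fun=> 1%E)); last first.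
  move=> x; rewrite inE/= in_itv/= => /andP[x0 xp].
  by rewrite /uniform_pdf x0 (le_trans xp p1) subr0 invr1.
rewrite integral_cst//= mul1e lebesgue_measure_itv/= lte_fin.
(* The interval formula treats an empty interior separately; there [p k] is zero. *)
by case: ltP => [_|p0']; rewrite ?sube0//; congr EFin; apply/eqP; rewrite eq_le p0 p0'.
Qed.

Let slab (b : bool) (k : K) : set R := if b then `]-oo, p k] else ~` `]-oo, p k].

Let mslab b k : measurable (slab b k).
Proof. by case: b; rewrite /slab; [|apply: measurableC]; exact: measurable_itv. Qed.

Let slabE b k : P (X k @^-1` slab b k) = (if b then p k else 1 - p k)%:E.
Proof.
case: b; first exact: below.
have mX : measurable (X k @^-1` `]-oo, p k]) by exact: measurable_funPTI.
by rewrite /slab preimage_setC (probability_setC P mX) below.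
Qed.

Let atomE f : [set omega | bits omega = f] =
  \bigcap_(k in [set` [set: K]%SET]) (X k @^-1` slab (f k) k).
Proof.
apply/seteqP; split => omega /=.
  by move=> <- k _; rewrite /slab ffunE /=; case: leP => h /=; rewrite in_itv/= ?h// leNgt h.
move=> h; apply/ffunP => k; rewrite ffunE.
have := h k (finset.in_setT k); rewrite /slab /=; case: (f k) => /=; rewrite in_itv/=.
  by move=> ->.
by move/negP/negbTE => ->.
Qed.

Let measurable_atom f : measurable [set omega | bits omega = f].
Proof.
rewrite atomE; apply: fin_bigcap_measurable => [|k _]; first exact: finite_finset.
exact: measurable_funPTI.
Qed.

Let atom_mass f : P [set omega | bits omega = f] = (bern_mass p f)%:E.
Proof.
rewrite atomE indX => [|k _]; last exact: mslab.
rewrite /bern_mass -prodEFin; apply: eq_big => [k|k _]; first by rewrite inE.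
exact: slabE.
Qed.

Let preimage_cons f (s : seq {ffun K -> bool}) : [set omega | bits omega \in f :: s] =
  [set omega | bits omega = f] `|` [set omega | bits omega \in s].
Proof.
apply/seteqP; split => omega /=; rewrite inE.
  by case/orP => [/eqP|]; [left|right].
by case=> [->|->]; rewrite ?eqxx ?orbT.
Qed.

Let measurable_seq (s : seq {ffun K -> bool}) : measurable [set omega | bits omega \in s].
Proof.
elim: s => [|f s IHs].
  by rewrite (_ : [set _ | _] = set0)//; apply/seteqP; split.
by rewrite preimage_cons; exact: measurableU.
Qed.

(** An event that depends only on the bits is a finite disjoint union of atoms, and independence
    gives each atom its product mass. This turns probabilities over the hash into finite sums. *)
Lemma threshold_event (Q : pred {ffun K -> bool}) :
  P [set omega | Q (bits omega)] = (bern_exp p (fun f => (Q f)%:R))%:E.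
Proof.
have key (s : seq {ffun K -> bool}) : uniq s ->
    P [set omega | bits omega \in s] = (\sum_(f <- s) bern_mass p f)%:E.
  elim: s => [_|f s IHs /andP[fs us]].
    rewrite big_nil (_ : [set _ | _] = set0) ?measure0//.
    by apply/seteqP; split.
  rewrite preimage_cons measureU//; first by rewrite big_cons EFinD -atom_mass -IHs.
  by apply/seteqP; split => omega //= [-> ]; rewrite (negbTE fs).
have -> : [set omega | Q (bits omega)] = [set omega | bits omega \in enum Q].
  by apply/seteqP; split => omega /=; rewrite mem_enum.
rewrite key ?enum_uniq// big_enum_cond/=; congr EFin.
rewrite /bern_exp big_mkcond; apply: eq_bigr => f _.
by rewrite unfold_in; case: (Q f); rewrite ?mulr1 ?mulr0.
Qed.

End IndependentThresholds.

(** Since [g <= 1/4], one has [N' >= 3 N / 4]. Over the common denominator [N' N] the numerator is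
    at most [6 g N^2], because [T <= N], and [6 / (3/4) = 8]. *)
Lemma ratio_estimate (R : realFieldType) (N T N' T' g : R) :
  0 < N -> 0 <= T <= N -> 0 <= g <= 4^-1 ->
  `|N' - N| <= g * N -> `|T' - T| <= g * N ->
  `|(if N' == 0 then 0 else 3 * T' / N') - 3 * T / N| <= 8 * g.
Proof.
move=> N0 /andP[T0 TN] /andP[g0 g4] dN dT.
have gN : g * N <= 4^-1 * N by rewrite ler_pM2r.
have N34 : 3 * N <= 4 * N' by move: dN; rewrite ler_norml => /andP[]; lra.
have N'0 : 0 < N' by lra.
rewrite gt_eqF//.
have -> : 3 * T' / N' - 3 * T / N = 3 * ((T' - T) * N - T * (N' - N)) / (N' * N).
  by field; rewrite !gt_eqF.
have NN : 0 < N' * N by rewrite mulr_gt0.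
rewrite normrM normfV (gtr0_norm NN) ler_pdivrMr// normrM (gtr0_norm (ltr0n _ 3)).
have h1 : `|(T' - T) * N| <= g * N * N by rewrite normrM (gtr0_norm N0) ler_pM2r.
have h2 : `|T * (N' - N)| <= N * (g * N).
  by rewrite normrM (ger0_norm T0) ler_pM.
have := ler_normB ((T' - T) * N) (T * (N' - N)).
have : g * N * (3 * N) <= g * N * (4 * N') by rewrite ler_wpM2l// mulr_ge0// ltW.
move: h1 h2; lra.
Qed.

(** * The three probability bounds *)

Theorem theorem3p6 (R : realType) :
  exists gamma0 : R, 0 < gamma0 /\
  forall (gamma : R), 0 < gamma -> gamma < gamma0 ->
  forall (V : finType) (es : seq (edge V)) (alpha beta : R) (Dt t : nat)
    (d : measure_display) (Omega : measurableType d) (P : probability Omega R)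
    (hash : hash_key V -> {RV P >-> R}),
  0 < alpha < 1 -> 0 < beta < 1 ->
  (1 <= t <= size es)%N ->
  random_hash hash ->
  gamma ^- 6 <= alpha ^+ 2 * beta * #|W_ es Dt t|%:R ->
  (#|E_ es Dt t| <= #|W_ es Dt t|)%N ->
  let h := fun (omega : Omega) (k : hash_key V) => hash k omega in
  [/\ (P [set omega | (`| W_hat alpha beta (h omega) es Dt t
                         - #|W_ es Dt t|%:R | > gamma * #|W_ es Dt t|%:R)%R]
         < gamma%:E)%E,
      (P [set omega | (`| T_hat alpha beta (h omega) es Dt t
                         - #|T_ es Dt t|%:R | > gamma * #|W_ es Dt t|%:R)%R]
         < gamma%:E)%E
    & (P [set omega | (`| tau_hat alpha beta (h omega) es Dt t
                         - tau_ es R Dt t | > 8 * gamma)%R]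
         < (4 * gamma)%R%:E)%E].
Proof.
exists 4000^-1; split; first by rewrite invr_gt0 ltr0n.
move=> gamma g0 gsmall V es alpha beta Dt t d Omega P hash a01 b01 _ [indh unifh] large _ h.
set N := #|W_ es Dt t|%:R in large *.
have /andP[a0 _] := a01; have /andP[b0 _] := b01.
have q0 : 0 < alpha ^+ 2 * beta by rewrite mulr_gt0 ?exprn_gt0.
have N0 : 0 < N.
  rewrite -(pmulr_rgt0 _ q0); apply: lt_le_trans large.
  by rewrite invr_gt0 exprn_gt0.
have x0 : 0 < Num.sqrt N by rewrite sqrtr_gt0.
have xN : Num.sqrt N ^+ 2 = N by rewrite sqr_sqrtr ?ltW.
have p01 := hash_prob01 (V := V) a01 b01.
pose dev (S : {set wedge V}) (f : {ffun hash_key V -> bool}) : R :=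
  (alpha ^+ 2 * beta)^-1 * \sum_(w in S) (sampled f w)%:R - #|S|%:R.
have tail (S : {set wedge V}) : S \subset W_ es Dt t ->
    bern_exp (hash_prob alpha beta) (fun f => (gamma * N < `|dev S f|)%R%:R) < gamma.
  move=> SW; rewrite -xN; apply: wedge_sample_tail => //; last 2 first.
  - by rewrite xN ler_nat subset_leq_card.
  - by rewrite xN.
  (* After squaring, the degree bound reads [deg^2 <= 9 N], and [incident_wedges] provides [8 N]. *)
  move=> e; rewrite -ler_sqr ?nnegrE ?mulr_ge0 ?(ltW x0)// exprMn xN.
  have le8 : (#|[set w in S | e \in val w]%SET| ^ 2 <= 8 * #|W_ es Dt t|)%N.
    apply: leq_trans (incident_wedges (E_ es Dt t) e).
    rewrite leq_sqr subset_leq_card//; apply/fintype.subsetP => w; rewrite !inE.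
    by case/andP=> /(fintype.subsetP SW); rewrite inE => -> ->.
  move: le8; rewrite -(ler_nat R) natrX natrM -/N => /le_trans; apply.
  by rewrite -natrX ler_pM2r// ler_nat.
have evt (Q : pred {ffun hash_key V -> bool}) :
    P [set omega | Q (hash_bits alpha beta (h omega))] =
    (bern_exp (hash_prob alpha beta) (fun f => (Q f)%:R))%:E.
  exact: threshold_event indh unifh p01 Q.
have tailW := tail _ (subxx _).
have TW : closed_wedges es Dt t \subset W_ es Dt t.
  by apply/fintype.subsetP => w; rewrite inE => /andP[].
have tailT := tail _ TW.
have devW omega : W_hat alpha beta (h omega) es Dt t - N =
    dev (W_ es Dt t) (hash_bits alpha beta (h omega)) by rewrite W_hatE.
have devT omega : T_hat alpha beta (h omega) es Dt t - #|T_ es Dt t|%:R =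
    dev (closed_wedges es Dt t) (hash_bits alpha beta (h omega)).
  by rewrite T_hatE -card_closed_wedges.
pose badW f := gamma * N < `|dev (W_ es Dt t) f|.
pose badT f := gamma * N < `|dev (closed_wedges es Dt t) f|.
split.
- under [X in P X]eq_set do rewrite devW.
  by rewrite (evt badW) lte_fin.
- under [X in P X]eq_set do rewrite devT.
  by rewrite (evt badT) lte_fin.
pose tau f : R := let w := dev (W_ es Dt t) f + N in
  if w == 0 then 0
  else 3 * (dev (closed_wedges es Dt t) f + #|T_ es Dt t|%:R) / w.
pose badtau f := 8 * gamma < `|tau f - tau_ es R Dt t|.
have -> : [set omega | (`|tau_hat alpha beta (h omega) es Dt t - tau_ es R Dt t| > 8 * gamma)%R]
    = [set omega | badtau (hash_bits alpha beta (h omega))].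
  apply/seteqP; split => omega /=; by rewrite /badtau /tau -devW -devT !subrK.
rewrite (evt badtau) lte_fin.
(* The union bound over the two bad events already gives [2 gamma]: outside both, [ratio_estimate]
   excludes a large error of the transitivity. *)
apply: (@le_lt_trans _ _ (gamma + gamma)); last by lra.
apply: le_trans (lerD (ltW tailW) (ltW tailT)).
rewrite -bern_expD; apply: le_bern_exp => // f.
rewrite -/(badW f) -/(badT f).
rewrite -natrD ler_nat.
have [_|gW] := boolP (badW f); first by case: (badtau f).
have [_|gT] := boolP (badT f); first by case: (badtau f).
rewrite leqn0 eqb0 -leNgt /tau /tau_ -/N; apply: ratio_estimate => //.
- by rewrite ler0n ler_nat -card_closed_wedges subset_leq_card.
- by rewrite (ltW g0); move: gsmall; lra.
- by rewrite addrK leNgt.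
- by rewrite addrK leNgt.
Qed.
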